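(* Let $\mathcal{A}$ be a finite set of actions, fix a state $s$, let $z(s,\cdot):\mathcal{A}\to\mathbb{R}$ be logits, and let $\pi_\theta(\cdot\mid s)$ be the reference policy with these logits, i.e. $\pi_\theta(a\mid s)=\dfrac{\exp(z(s,a))}{\sum_{b\in\mathcal{A}}\exp(z(s,b))}$ for $a\in\mathcal{A}$. Let $\widehat A(s,\cdot):\mathcal{A}\to\mathbb{R}$ be any real-valued function (the estimated advantage) and let $\beta>0$. Consider the problem, over all probability distributions $\pi'$ on $\mathcal{A}$, $$\pi^* = \arg\max_{\pi'}\left(\mathbb{E}_{a\sim\pi'}\big[\widehat A(s,a)\big]-\frac{1}{\beta}D_{KL}\big(\pi'\,\|\,\pi_\theta(\cdot\mid s)\big)\right).$$ Then the solution $\pi^*$ of this problem is the policy with logits $$z'(s,a)=z(s,a)+\beta\,\widehat A(s,a),\qquad a\in\mathcal{A},$$ that is, $\pi^*(a)=\dfrac{\exp(z'(s,a))}{\sum_{b\in\mathcal{A}}\exp(z'(s,b))}$ for all $a\in\mathcal{A}$.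
   Context: For probability distributions $p,q$ on a finite set $\mathcal{A}$ with $q(a)>0$ for all $a$, $D_{KL}(p\|q)=\sum_{a\in\mathcal{A}}p(a)\log\frac{p(a)}{q(a)}$, with the convention $0\log 0=0$. A distribution on $\mathcal{A}$ ''has logits $z$'' if it equals the softmax of $z$. *)

(* Defs.v *)
From HB Require Import structures.
From mathcomp Require Import all_boot all_order all_algebra.
From mathcomp Require Import classical_sets reals sequences exp.

Set Implicit Arguments.
Unset Strict Implicit.
Unset Printing Implicit Defensive.

Import Order.TTheory GRing.Theory Num.Theory.

Local Open Scope classical_set_scope.
Local Open Scope ring_scope.

Definition distribution (R : realType) (A : finType) : set (A -> R) :=
  [set p | (forall a, 0 <= p a) /\ \sum_(a : A) p a = 1].

Arguments distribution : clear implicits.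

Definition softmax (R : realType) (A : finType) (z : A -> R) : A -> R :=
  fun a => expR (z a) / \sum_(b : A) expR (z b).

Definition has_logits (R : realType) (A : finType) (p z : A -> R) : Prop :=
  forall a, p a = softmax z a.

Definition expectation (R : realType) (A : finType) (p f : A -> R) : R :=
  \sum_(a : A) p a * f a.

(* The convention 0 log 0 = 0 needs no case distinction: [ln] is total, so a
   term with [p a = 0] is [0 * _ = 0]. Only meaningful when [q] is positive. *)
Definition KL (R : realType) (A : finType) (p q : A -> R) : R :=
  \sum_(a : A) p a * ln (p a / q a).

Definition argmax (R : realType) (T : Type) (D : set T) (f : T -> R) : set T :=
  [set x | D x /\ forall y, D y -> f y <= f x].

(* Main.v *)
(** By [objective_KL], up to an additive constant the objective is
    [- beta^-1 * KL p q'] with [q'] the softmax of [z + beta * Ahat]. By Gibbs'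
    inequality [KL p q'] is nonnegative and vanishes exactly at [p = q']. *)
Require Import Defs.
From mathcomp Require Import all_boot all_order all_algebra.
From mathcomp Require Import classical_sets reals sequences exp.
From mathcomp Require Import ring lra.

Import Order.TTheory GRing.Theory Num.Theory.

Local Open Scope classical_set_scope.
Local Open Scope ring_scope.

Lemma partition_function_gt0 {R : realType} {A : finType} (z : A -> R) :
  (0 < #|A|)%N -> 0 < \sum_(b : A) expR (z b).
Proof.
case/card_gt0P => a _; rewrite (bigD1 a) //= ltr_wpDr ?expR_gt0 //.
by apply: sumr_ge0 => b _; exact: expR_ge0.
Qed.

Lemma softmax_gt0 {R : realType} {A : finType} (z : A -> R) a :
  (0 < #|A|)%N -> 0 < softmax z a.
Proof. by move=> A0; rewrite divr_gt0 ?expR_gt0 ?partition_function_gt0. Qed.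

Lemma softmax_distribution {R : realType} {A : finType} (z : A -> R) :
  (0 < #|A|)%N -> distribution R A (softmax z).
Proof.
move=> A0; split=> [a|]; first exact/ltW/softmax_gt0.
by rewrite -mulr_suml mulfV // gt_eqF ?partition_function_gt0.
Qed.

Lemma has_logits_distribution {R : realType} {A : finType} (p z : A -> R) :
  (0 < #|A|)%N -> has_logits p z -> distribution R A p.
Proof.
move=> A0 pz; have [z_ge0 z_sum1] := softmax_distribution z A0.
by split=> [a|]; [rewrite pz | rewrite (eq_bigr _ (fun a _ => pz a))].
Qed.

(** For [x > 0] and [t = ln (y / x)], this is the tangent bound [1 + t <= expR t], strict unless
    [t = 0], multiplied by [x]. *)
Lemma mul_ln_div_ge {R : realType} (x y : R) :
  0 <= x -> 0 < y -> x - y <= x * ln (x / y) ?= iff (x == y).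
Proof.
rewrite le_eqVlt => /predU1P[<- y0|x0 y0].
  (* At [x = 0] the bound reads [- y <= 0]; it is strict because [y > 0], in agreement with
     [x != y]. *)
  rewrite mul0r sub0r (lt_eqF y0); split; first lra.
  by apply/negbTE; rewrite lt_eqF //; lra.
have x_neq0 : x != 0 by rewrite gt_eqF.
have lnN : ln (x / y) = - ln (y / x) by rewrite !ln_div ?posrE // opprB.
have yE : y = x * expR (ln (y / x)).
  by rewrite lnK ?posrE ?divr_gt0 // mulrC divfK.
have [<-|xy] := eqVneq x y.
  by rewrite divff // ln1 mulr0 subrr; apply/leif_refl.
have t0 : ln (y / x) != 0.
  by apply: contra_neq xy => t0; rewrite yE t0 expR0 mulr1.
suff lt_xy : x - y < x * ln (x / y).
  by split; [exact: ltW | rewrite lt_eqF].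
have := expR_gt1Dx t0; rewrite -(ltr_pM2l x0) -yE lnN; lra.
Qed.

(** Both masses are 1, so the lower bounds [p a - q a] of the terms sum to 0; equality of the sums
    forces equality in every term. *)
Lemma gibbs_inequality {R : realType} {A : finType} (p q : A -> R) :
  distribution R A p -> distribution R A q -> (forall a, 0 < q a) ->
  0 <= KL p q ?= iff [forall a, p a == q a].
Proof.
move=> [p0 p1] [_ q1] q0.
have -> : 0 = \sum_a (p a - q a) by rewrite sumrB p1 q1 subrr.
by apply: leif_sum => a _; exact: mul_ln_div_ge.
Qed.

(** Since [ln (q a)] is [z a] minus the log-partition constant and [p] has mass 1, the divergence
    splits into negative entropy, a linear term and that constant. *)
Lemma KL_has_logits {R : realType} {A : finType} (p q z : A -> R) :
  (0 < #|A|)%N -> distribution R A p -> has_logits q z ->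
  KL p q = \sum_a p a * ln (p a) - expectation p z + ln (\sum_b expR (z b)).
Proof.
move=> A0 [p0 p1] qz; have Z0 := partition_function_gt0 z A0.
rewrite -[ln (\sum_b _)]mul1r -p1 mulr_suml -sumrB -big_split /=.
apply: eq_bigr => a _; have := p0 a.
(* The case [p a = 0] is separate because [ln_div] requires a positive numerator. *)
rewrite le_eqVlt => /predU1P[<-|pa]; first by rewrite !mul0r subrr addr0.
rewrite ln_div ?posrE ?qz ?softmax_gt0 // ln_div ?posrE ?expR_gt0 // expRK.
by ring.
Qed.

(** The entropy of [p] occurs in both divergences and cancels; the shift of the logits by [beta * f]
    absorbs the expected advantage. *)
Lemma objective_KL {R : realType} {A : finType} (p q q' z f : A -> R) (beta : R) :
  (0 < #|A|)%N -> beta != 0 -> distribution R A p ->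
  has_logits q z -> has_logits q' (fun a => z a + beta * f a) ->
  expectation p f - beta^-1 * KL p q =
  beta^-1 * (ln (\sum_b expR (z b + beta * f b)) - ln (\sum_b expR (z b))
             - KL p q').
Proof.
move=> A0 b0 pd qz qz'.
rewrite (KL_has_logits _ _ _ A0 pd qz) (KL_has_logits _ _ _ A0 pd qz').
have -> : expectation p (fun a => z a + beta * f a)
          = expectation p z + beta * expectation p f.
  rewrite /expectation mulr_sumr -big_split; apply: eq_bigr => a _ /=; ring.
by field.
Qed.

Theorem theorem4p1 (R : realType) (S : Type) (A : finType)
    (A_nonempty : (0 < #|A|)%N) (s : S)
    (z : S -> A -> R) (pi_theta : S -> A -> R)
    (pi_theta_logits : has_logits (pi_theta s) (z s))
    (Ahat : S -> A -> R) (beta : R) (beta_gt0 : 0 < beta) :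
  let objective (p : A -> R) :=
    expectation p (Ahat s) - beta^-1 * KL p (pi_theta s) in
  let z' (a : A) := z s a + beta * Ahat s a in
  (exists pistar, argmax (distribution R A) objective pistar) /\
  (forall pistar, argmax (distribution R A) objective pistar <->
                  has_logits pistar z').
Proof.
move=> objective z'.
have q'd := softmax_distribution z' A_nonempty.
have q'0 a : 0 < softmax z' a by exact: softmax_gt0.
(* The log-partition terms do not depend on the distribution and [beta^-1 > 0], so maximizing the
   objective is minimizing the divergence from [softmax z']. *)
have objectiveE p p' : distribution R A p -> distribution R A p' ->
    (objective p <= objective p')
    = (KL p' (softmax z') <= KL p (softmax z')).
  move=> pd p'd; rewrite /objective.
  rewrite (objective_KL _ _ (softmax z') _ _ _ A_nonempty _ pd pi_theta_logits) //;
    last by rewrite gt_eqF.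
  rewrite (objective_KL _ _ (softmax z') _ _ _ A_nonempty _ p'd pi_theta_logits) //;
    last by rewrite gt_eqF.
  by rewrite ler_pM2l ?invr_gt0 // lerD2l lerN2.
have KL_eq0 p : distribution R A p -> has_logits p z' -> KL p (softmax z') = 0.
  move=> pd pz'; apply/esym/eqP; rewrite (gibbs_inequality _ _ pd q'd q'0).
  by apply/forallP => a; rewrite pz'.
have sufficient p : has_logits p z' -> argmax (distribution R A) objective p.
  move=> pz'; have pd := has_logits_distribution _ _ A_nonempty pz'.
  split=> // r rd; rewrite objectiveE // KL_eq0 //.
  by rewrite (gibbs_inequality _ _ rd q'd q'0).
split=> [|p]; first by exists (softmax z'); exact: sufficient.
split=> [[pd p_max] a|]; last exact: sufficient.
(* Testing maximality against [softmax z'] itself gives [KL p (softmax z') <= 0], which is the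
   equality case of Gibbs' inequality. *)
have := p_max _ q'd; rewrite objectiveE // (KL_eq0 _ q'd) //.
by rewrite (ge_leif (gibbs_inequality _ _ pd q'd q'0)) => /forallP/(_ a)/eqP.
Qed.
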